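(* Let $G=(V,E)$ be a graph with a multiset $R=\{r_1,\dots,r_t\}$ of vertices of $V$, and let $\mathcal{M}$ be a matroid on $R$ of rank $k$ with rank function $r_{\mathcal{M}}:2^{R}\to\mathbb{Z}$. Then $(G,R)$ admits a basic rooted-tree decomposition with respect to $\mathcal{M}$ if and only if the following three conditions hold: (C1) $R_v$ is independent in $\mathcal{M}$ for each $v\in V$; (C2) $|F|+|R_F|\le k|V(F)|-k+r_{\mathcal{M}}(R_F)$ for every non-empty $F\subseteq E$; (C3) $|E|+|R|=k|V|$.
   Context: Graphs are finite and undirected. For $F\subseteq E$, $V(F)$ is the set of vertices incident to edges of $F$. The multiset $R=\{r_1,\dots,r_t\}$ is regarded as a family indexed by $1,\dots,t$ (different indices are different elements of $R$, even if they are the same vertex of $V$); a matroid on $R$ has these $t$ elements as ground set, and cardinalities of sub-multisets count multiplicity. For $v\in V$, $R_v=\{r_i\in R\mid r_i=v\}$, and for $F\subseteq E$, $R_F=\{r_i\in R\mid r_i\in V(F)\}$, as multi-subsets of $R$. A pair $(T,r)$ with $T\subseteq E$, $r\in V$ is a rooted-tree if either $T=\emptyset$, or $T$ is connected without cycles and $r\in V(T)$. Put $V(T,r)=V(T)\cup\{r\}$ (so $V(\emptyset,r)=\{r\}$). $(G,R)$ admits a basic rooted-tree decomposition with respect to $\mathcal{M}$ if $E$ can be partitioned into pairwise disjoint sets $T_1,\dots,T_t$ (where $T_i=\emptyset$ is allowed) such that each $(T_i,r_i)$ is a rooted-tree and, for each $v\in V$, the multiset $\{r_i\in R\mid v\in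 V(T_i,r_i)\}$ is a base of $\mathcal{M}$. *)

(* Defs.v *)
(* Mathematical Components *)
From mathcomp Require Import all_boot.

Set Implicit Arguments.
Unset Strict Implicit.
Unset Printing Implicit Defensive.

Record matroid (T : finType) := Matroid {
  indep : pred {set T};
  indep0 : indep set0;
  indepS : forall A B : {set T}, A \subset B -> indep B -> indep A;
  indep_aug : forall A B : {set T}, indep A -> indep B -> #|A| < #|B| ->
    exists2 x, x \in B :\: A & indep (x |: A)
}.

Definition is_base (T : finType) (M : matroid T) (B : {set T}) : bool :=
  maxset (indep M) B.

Definition mrank (T : finType) (M : matroid T) (A : {set T}) : nat :=
  \max_(I : {set T} | indep M I && (I \subset A)) #|I|.

(* Undirected multigraphs: distinct edges may have the same ends, and an edge
   with a single end is a loop. *)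
Record mgraph (V E : finType) := MGraph {
  ends : E -> {set V};
  card_ends : forall e : E, 0 < #|ends e| <= 2
}.

Section Graph.
Variables (V E : finType) (G : mgraph V E).
Implicit Types (F T : {set E}) (u v x : V).

Definition vset F : {set V} := \bigcup_(e in F) ends G e.

Definition adj F : rel V :=
  fun u v => [exists e in F, ends G e == [set u; v]].

Definition connected_edges F : Prop :=
  {in vset F &, forall u v, connect (adj F) u v}.

(* The i-th edge of es joins the i-th vertex of vs to the cyclically next one,
   which also forces size es = size vs.  A loop is a cycle of length 1 and a
   pair of parallel edges is a cycle of length 2. *)
Definition is_cycle F (vs : seq V) (es : seq E) : Prop :=
  [/\ es != [::], uniq vs, uniq es, {subset es <= F} &
      [seq ends G e | e <- es] =
      [seq [set p.1; p.2] | p <- zip vs (rot 1 vs)]].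

Definition acyclic F : Prop :=
  forall (vs : seq V) (es : seq E), ~ is_cycle F vs es.

Definition rooted_tree T x : Prop :=
  T = set0 \/ [/\ connected_edges T, acyclic T & x \in vset T].

Definition rooted_vset T x : {set V} := x |: vset T.

(* The multiset R = {r_1, ..., r_t} is the family r; its sub-multisets are
   sets of indices. *)
Section Roots.
Variables (t : nat) (r : 'I_t -> V).

Definition roots_at v : {set 'I_t} := [set i | r i == v].

Definition roots_in F : {set 'I_t} := [set i | r i \in vset F].

Definition basic_rooted_tree_decomposition (M : matroid 'I_t)
    (T : 'I_t -> {set E}) : Prop :=
  [/\ \bigcup_i T i = [set: E],
      forall i j, i != j -> [disjoint T i & T j],
      forall i, rooted_tree (T i) (r i) &
      forall v, is_base M [set i | v \in rooted_vset (T i) (r i)]].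

Definition admits_basic_rooted_tree_decomposition (M : matroid 'I_t) : Prop :=
  exists T : 'I_t -> {set E}, basic_rooted_tree_decomposition M T.

End Roots.
End Graph.

(* Main.v *)
(* Sufficiency.  Grow the trees [T i] one edge at a time.  Let [P v] be the set
   of indices whose current tree contains [v], [D] the set of unused edges,
   [p X] the sum of [k - #|P v|] over [v] in [X], and [P_X] the union of the
   [P v].  Conditions (C1)-(C3) are maintained in the form: every [P v] is
   independent, [i_D(X) + k <= p X + rank P_X] for all non-empty vertex sets
   [X], with [i_D(X)] the number of edges of [D] inside [X], and [#|D| = p V].
   The difference of the two sides of the inequality is an intersecting
   submodular function, so tight sets that meet are closed under intersection.
   Extending the tree of [i \in P u] along an edge [uv] destroys the invariant
   only through a tight [X] containing [v] but not [u] whose [P_X] spans [i].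
   Take a minimal tight [Z] containing an edge [uv] with [P u] not spanned by
   [P v], and [i] in [P u] outside the span of [P v].  For an obstacle [X],
   submodularity of the rank shows that [P_(X :&: Z)] spans [i]; but by
   minimality all edges inside [X :&: Z] have ends with equal spans, and then
   tightness forces [rank P_(X :&: Z) = rank (P v)], a contradiction.

   Necessity.  For a non-empty [F], a forest [F :&: T i] has fewer edges than
   [T i] has vertices in [V(F)], and the [i] whose tree meets [V(F)] contain a
   base in addition to [R_F]. *)
Require Import Defs.
From mathcomp Require Import all_boot all_order all_algebra.
From mathcomp Require Import zify.

Set Implicit Arguments.
Unset Strict Implicit.
Unset Printing Implicit Defensive.

(** * Rank and span in a matroid *)

Section MatroidRank.
Variables (T : finType) (M : matroid T).
Implicit Types (A B C I : {set T}) (x : T).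

Lemma indep_leq_mrank I A : indep M I -> I \subset A -> #|I| <= mrank M A.
Proof. by move=> iI sIA; apply: leq_bigmax_cond; rewrite iI. Qed.

Lemma mrank_basis A : exists I, [/\ indep M I, I \subset A & #|I| = mrank M A].
Proof.
have P0 : indep M set0 && (set0 \subset A) by rewrite indep0 sub0set.
have [|I /andP[iI sIA] eI] :=
  @eq_bigmax_cond _ (fun I => indep M I && (I \subset A)) (fun I : {set T} => #|I|).
  by apply/card_gt0P; exists set0.
by exists I; rewrite iI sIA /mrank eI.
Qed.

Lemma mrankS A B : A \subset B -> mrank M A <= mrank M B.
Proof.
move=> sAB; have [I [iI sIA <-]] := mrank_basis A.
exact: indep_leq_mrank iI (subset_trans sIA sAB).
Qed.

Lemma mrank_leq_card A : mrank M A <= #|A|.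
Proof. by have [I [_ sIA <-]] := mrank_basis A; apply: subset_leq_card. Qed.

Lemma indep_mrank A : indep M A -> mrank M A = #|A|.
Proof.
by move=> iA; apply/eqP; rewrite eqn_leq mrank_leq_card indep_leq_mrank.
Qed.

Lemma mrank_card_indep A : mrank M A = #|A| -> indep M A.
Proof.
move=> rA; have [I [iI sIA cI]] := mrank_basis A.
suff -> : A = I by [].
by apply/esym/eqP; rewrite eqEcard sIA cI rA leqnn.
Qed.

Lemma indep_extend I A : indep M I -> I \subset A ->
  exists J, [/\ indep M J, I \subset J, J \subset A & #|J| = mrank M A].
Proof.
move=> iI sIA.
have [|J /maxsetP[/andP[iJ sJA] maxJ] sIJ] :=
  @maxset_exists _ (fun J => indep M J && (J \subset A)) I; first by rewrite iI.
exists J; split=> //; apply/eqP; rewrite eqn_leq indep_leq_mrank //= leqNgt.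
apply/negP=> ltJ; have [K [iK sKA cK]] := mrank_basis A.
rewrite -cK in ltJ; have [x /setDP[xK xJ] ixJ] := indep_aug iJ iK ltJ.
case/negP: xJ; rewrite -(maxJ (x |: J)) ?setU11 ?subsetU1 // ixJ subUset sJA.
by rewrite sub1set (subsetP sKA).
Qed.

(** A basis [J] of the union that extends a basis [I] of the intersection meets [A] and [B] in
    independent sets, whose sizes add up to [#|J| + #|J :&: (A :&: B)|]; the last set contains
    [I]. *)
Lemma mrank_submod A B :
  mrank M (A :|: B) + mrank M (A :&: B) <= mrank M A + mrank M B.
Proof.
have [I [iI sI cI]] := mrank_basis (A :&: B).
have [|J [iJ sIJ sJ cJ]] := @indep_extend I (A :|: B) iI.
  by rewrite (subset_trans sI) // subIset // subsetUl.
have lA : #|J :&: A| <= mrank M A.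
  by apply: indep_leq_mrank (subsetIr _ _); apply: indepS iJ; apply: subsetIl.
have lB : #|J :&: B| <= mrank M B.
  by apply: indep_leq_mrank (subsetIr _ _); apply: indepS iJ; apply: subsetIl.
have := cardsUI (J :&: A) (J :&: B); rewrite -setIUr (setIidPl sJ) setIACA setIid.
have : #|I| <= #|J :&: (A :&: B)| by rewrite subset_leq_card // subsetI sIJ.
lia.
Qed.

Lemma mrankU_card A B : mrank M (A :|: B) <= mrank M A + #|B|.
Proof. by have := mrank_submod A B; have := mrank_leq_card B; lia. Qed.

Lemma is_baseE B : is_base M B = indep M B && (#|B| == mrank M setT).
Proof.
apply/maxsetP/andP=> [[iB maxB]|[iB /eqP cB]]; split=> //.
- have [J [iJ sBJ _ <-]] := indep_extend iB (subsetT B).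
  by rewrite (maxB J).
- move=> A iA sBA; apply/esym/eqP; rewrite eqEcard sBA cB.
  exact: indep_leq_mrank (subsetT A).
Qed.

(** The closure operator of the matroid. *)
Definition mspan A : {set T} := [set x | mrank M (x |: A) == mrank M A].

(** If the rank grew, augmenting a basis of [A] from one of [A :|: B] would give a single element
    raising the rank of [A]. *)
Lemma mrankU_span A B : B \subset mspan A -> mrank M (A :|: B) = mrank M A.
Proof.
move=> sBA; apply/eqP; rewrite eqn_leq andbC mrankS ?subsetUl //= leqNgt.
apply/negP=> lt; have [I [iI sIA cI]] := mrank_basis A.
have [J [iJ sJ cJ]] := mrank_basis (A :|: B).
rewrite -cI -cJ in lt; have [x /setDP[xJ xI] ixI] := indep_aug iI iJ lt.
have : #|x |: I| <= mrank M (x |: A) by apply: indep_leq_mrank => //; apply: setUS.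
rewrite cardsU1 xI cI.
have : mrank M (x |: A) = mrank M A.
  have /setUP[xA|xB] := subsetP sJ x xJ.
  - by rewrite (setUidPr _) ?sub1set.
  - by have := subsetP sBA x xB; rewrite inE => /eqP.
lia.
Qed.

Lemma sub_mspan A : A \subset mspan A.
Proof. by apply/subsetP=> x xA; rewrite inE (setUidPr _) // sub1set. Qed.

Lemma mspanS A B : A \subset B -> mspan A \subset mspan B.
Proof.
move=> sAB; apply/subsetP=> x; rewrite !inE => /eqP xA.
rewrite eqn_leq andbC mrankS ?subsetUr //=.
have := mrank_submod (x |: A) B; rewrite -setUA (setUidPr sAB) xA.
have : mrank M A <= mrank M ((x |: A) :&: B).
  by apply: mrankS; rewrite subsetI subsetUr.
lia.
Qed.

Lemma mspan_rank_eq A B : A \subset B -> mrank M B = mrank M A -> mspan B \subset mspan A.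
Proof.
move=> sAB rB; apply/subsetP=> x; rewrite !inE => /eqP xB.
by rewrite eqn_leq andbC mrankS ?subsetUr //= -rB -xB mrankS // setUS.
Qed.

Lemma mspan_sub_trans A B C :
  B \subset mspan A -> C \subset mspan B -> C \subset mspan A.
Proof.
move=> sBA sCB; apply: subset_trans sCB _.
apply: subset_trans (mspanS (subsetUr A B)) _.
exact: mspan_rank_eq (subsetUl A B) (mrankU_span sBA).
Qed.

Lemma mrank_notin_span A x : x \notin mspan A -> mrank M (x |: A) = (mrank M A).+1.
Proof.
rewrite inE => nx; have := mrankU_card A [set x]; rewrite setUC cards1.
have := mrankS (subsetUr [set x] A); move: nx; rewrite neq_ltn => /orP; lia.
Qed.

End MatroidRank.

(** * Modular sums and edges induced on vertex sets *)

Lemma sum_setUI (V : finType) (q : V -> nat) (X Y : {set V}) :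
  \sum_(v in X :|: Y) q v + \sum_(v in X :&: Y) q v =
  \sum_(v in X) q v + \sum_(v in Y) q v.
Proof.
rewrite (big_setID Y (A := X)) (big_setID Y (A := X :|: Y)) /=.
by rewrite (setIidPr (subsetUr _ _)) setDUl setDv setU0; lia.
Qed.

Section InducedEdges.
Variables (V E : finType) (G : mgraph V E).
Implicit Types (D F : {set E}) (X Y : {set V}) (e : E) (u v : V).

Definition induced D X : {set E} := [set e in D | ends G e \subset X].

(** A loop gives [u = v]. *)
Lemma ends_pair e : exists u v, ends G e = [set u; v].
Proof.
have /andP[] := card_ends G e; case: (set_0Vmem (ends G e)) => [->|[u ue] _].
  by rewrite cards0.
rewrite (cardsD1 u) ue ltnS => le1.
have [e0|[v /setD1P[vu ve]]] := set_0Vmem (ends G e :\ u).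
  by exists u, u; rewrite -(setD1K ue) e0 setU0 setUid.
exists u, v; rewrite -(setD1K ue); congr (_ |: _).
apply/esym/eqP; rewrite eqEcard sub1set !inE vu ve cards1; exact: le1.
Qed.

Lemma sub_ends_vset F e : e \in F -> ends G e \subset vset G F.
Proof. by move=> eF; apply: (bigcup_max e). Qed.

Lemma vset_subP F X : reflect {in F, forall e, ends G e \subset X} (vset G F \subset X).
Proof. exact: bigcupsP. Qed.

Lemma vsetS F F' : F \subset F' -> vset G F \subset vset G F'.
Proof.
by move=> sF; apply/vset_subP=> e eF; apply: sub_ends_vset; apply: (subsetP sF).
Qed.

Lemma vsetU1 e F : vset G (e |: F) = ends G e :|: vset G F.
Proof. by rewrite /vset bigcup_setU big_set1. Qed.

Lemma induced_supermod D X Y :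
  #|induced D X| + #|induced D Y| <=
  #|induced D (X :|: Y)| + #|induced D (X :&: Y)|.
Proof.
rewrite -cardsUI leq_add ?subset_leq_card //; apply/subsetP=> e; rewrite !inE.
  by case/orP=> /andP[-> s] /=; apply: subset_trans s _;
    rewrite ?subsetUl ?subsetUr.
by case/andP=> /andP[-> sX] /andP[_ sY]; rewrite subsetI sX.
Qed.

End InducedEdges.

(** * Tight sets and safe moves of roots *)

Section Exchange.
Variables (V E I : finType) (G : mgraph V E) (M : matroid I).
Implicit Types (D F : {set E}) (X Y Z C : {set V}) (e : E) (u v w : V) (i : I).
Implicit Type P : V -> {set I}.

Local Notation k := (mrank M setT).
Local Notation rk := (mrank M).

Definition cup P X : {set I} := \bigcup_(v in X) P v.

Lemma cupS P X Y : X \subset Y -> cup P X \subset cup P Y.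
Proof.
by move=> sXY; apply/bigcupsP=> v vX; apply: (bigcup_max v) => //; apply: (subsetP sXY).
Qed.

Lemma sub_cup P X v : v \in X -> P v \subset cup P X.
Proof. by move=> vX; apply: (bigcup_max v). Qed.

Lemma cupU P X Y : cup P (X :|: Y) = cup P X :|: cup P Y.
Proof. exact: bigcup_setU. Qed.

(** Together with [capacity] this states the invariant [i_D(X) + k <= p X + rank P_X]; the terms of
    each [k - #|P v|] are put on opposite sides to avoid truncated subtraction. *)
Definition demand D P X := #|induced G D X| + \sum_(v in X) #|P v| + k.

Definition capacity P X := k * #|X| + rk (cup P X).

(* (C2) for arbitrary vertex sets, with [P v] in the role of [R_v]. *)
Definition sparse D P := forall X, X != set0 -> demand D P X <= capacity P X.

Definition tight D P X := (X != set0) && (demand D P X == capacity P X).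

(* A tight set inside which roots can still travel along some edge. *)
Definition has_active D P X := [exists e in D, [exists u, [exists v,
  [&& ends G e == [set u; v], ends G e \subset X & ~~ (P u \subset mspan M (P v))]]]].

Section State.
Variables (D : {set E}) (P : V -> {set I}).
Hypotheses (iP : forall v, indep M (P v)) (sp : sparse D P).

Lemma cup1 v : cup P [set v] = P v.
Proof. exact: big_set1. Qed.

(** Apart from the edge count, both sides agree on a singleton because [P v] is independent.
    Sparsity then leaves no room for loops. *)
Lemma tight1 v : tight D P [set v].
Proof.
have ne : [set v] != set0 by apply/set0Pn; exists v; rewrite inE.
rewrite /tight ne eqn_leq sp //= /demand /capacity cup1 cards1 big_set1 (indep_mrank (iP v)).
lia.
Qed.

Lemma induced1 v : induced G D [set v] = set0.
Proof.
apply/eqP; rewrite -cards_eq0; have /andP[_ /eqP] := tight1 v.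
rewrite /demand /capacity cup1 cards1 big_set1 (indep_mrank (iP v)); lia.
Qed.

Lemma edge_neq e u v : e \in D -> ends G e = [set u; v] -> u != v.
Proof.
move=> eD Ee; apply/eqP=> uv; have := in_set0 e; rewrite -(induced1 v).
by rewrite inE eD Ee uv setUid subxx.
Qed.

(** Edge counts are supermodular, vertex sums modular and ranks submodular, so sparsity of the union
    and the intersection forces equality throughout. *)
Lemma tightI X Y : tight D P X -> tight D P Y -> X :&: Y != set0 ->
  tight D P (X :&: Y) /\
  rk (cup P (X :|: Y)) + rk (cup P (X :&: Y)) = rk (cup P X) + rk (cup P Y).
Proof.
case/andP=> X0 /eqP tX /andP[Y0 /eqP tY] XY0.
have U0 : X :|: Y != set0 by rewrite setU_eq0 negb_and X0.
have := sp U0; have := sp XY0; rewrite /tight XY0 /=.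
have := mrank_submod M (cup P X) (cup P Y); rewrite -cupU.
have : rk (cup P (X :&: Y)) <= rk (cup P X :&: cup P Y).
  by apply: mrankS; rewrite subsetI !cupS ?subsetIl ?subsetIr.
have := induced_supermod G D X Y; have := sum_setUI (fun v => #|P v|) X Y.
have : k * #|X :|: Y| + k * #|X :&: Y| = k * #|X| + k * #|Y|.
  by rewrite -!mulnDr cardsUI.
move: tX tY; rewrite /demand /capacity => *; split; first apply/eqP; lia.
Qed.

(* The vertices of [Y] whose roots are spanned by those of [v] form a union
   of components of the graph induced on [Y]; apply sparsity to it and to its
   complement in [Y]. *)
Lemma rank_inactive_tight Y v : tight D P Y -> ~~ has_active D P Y -> v \in Y ->
  rk (cup P Y) = #|P v|.
Proof.
case/andP=> Y0 /eqP tY nY vY.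
have spanE e u w : e \in D -> ends G e = [set u; w] -> ends G e \subset Y ->
    P u \subset mspan M (P w).
  move=> eD Ee eY; apply: contraR nY => nuw; apply/exists_inP; exists e => //.
  by apply/existsP; exists u; apply/existsP; exists w; rewrite nuw eY Ee eqxx.
set C := [set w in Y | P w \subset mspan M (P v)].
have vC : v \in C by rewrite inE vY sub_mspan.
have sCY : C \subset Y by apply/subsetP=> w; rewrite inE => /andP[].
have rC : rk (cup P C) = #|P v|.
  have sC : cup P C \subset mspan M (P v).
    by apply/bigcupsP=> w; rewrite inE => /andP[].
  rewrite -(indep_mrank (iP v)) -(mrankU_span sC) (setUidPr _) //.
  exact: sub_cup vC.
have [CY|DY0] := eqVneq (Y :\: C) set0.
  rewrite -rC; congr (rk (cup P _)); apply/eqP.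
  by rewrite eqEsubset sCY -setD_eq0 CY eqxx.
have C0 : C != set0 by apply/set0Pn; exists v.
have split_edges : #|induced G D Y| <= #|induced G D C| + #|induced G D (Y :\: C)|.
  rewrite (leq_trans _ (leq_card_setU _ _)) // subset_leq_card //.
  apply/subsetP=> e; rewrite !(inE, in_setU) => /andP[eD eY]; rewrite eD /=.
  have [u [w Ee]] := ends_pair G e.
  have := eY; rewrite Ee subUset !sub1set => /andP[uY wY].
  have uw := spanE e u w eD Ee eY.
  have wu := spanE e w u eD (etrans Ee (setUC _ _)) eY.
  have CE : (u \in C) = (w \in C).
    by rewrite !inE uY wY /=; apply/idP/idP => s; apply: mspan_sub_trans s _.
  by rewrite !subUset !sub1set !in_setD uY wY CE; case: (w \in C).
(* When the two sparsity bounds are added, the rank on [Y :\: C] is at most [k] and cancels one of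
   the two terms [k]. *)
have := sp C0; have := sp DY0; have := tY; rewrite /demand /capacity rC.
rewrite (big_setID C (A := Y)) /= (setIidPr sCY).
have cY : k * #|Y| = k * #|C| + k * #|Y :\: C|.
  by rewrite -mulnDr -(cardsID C Y) (setIidPr sCY).
have : rk (cup P (Y :\: C)) <= k by apply: mrankS; apply: subsetT.
have : #|P v| <= rk (cup P Y) by rewrite -(indep_mrank (iP v)) mrankS // sub_cup.
lia.
Qed.

Hypotheses (tot : #|D| + \sum_v #|P v| = k * #|V|) (D0 : D != set0).

(** By [tot] the demand of [V] is [k * #|V| + k], which its capacity cannot exceed. *)
Lemma tightT_rank : tight D P setT /\ rk (cup P setT) = k.
Proof.
have [e eD] := set0Pn _ D0; have [u _] := ends_pair G e.
have ne : [set: V] != set0 by apply/set0Pn; exists u; rewrite inE.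
have := sp ne; rewrite /tight ne /= /demand /capacity cardsT.
have -> : induced G D setT = D by apply/setP=> e'; rewrite inE subsetT andbT.
have -> : \sum_(v in [set: V]) #|P v| = \sum_v #|P v|.
  by apply: eq_bigl => v; rewrite inE.
have : rk (cup P setT) <= k by apply: mrankS; apply: subsetT.
by split; first apply/eqP; lia.
Qed.

(** Otherwise every [P v] would have size [k], and [tot] would leave no edge in [D]. *)
Lemma has_activeT : has_active D P setT.
Proof.
have [tT rT] := tightT_rank; apply: contraT => nT.
have full v : #|P v| = k by rewrite -(rank_inactive_tight tT nT (in_setT v)).
have : \sum_v #|P v| = k * #|V|.
  by rewrite (eq_bigr (fun=> k)) => [|v _]; rewrite ?sum_nat_const 1?mulnC.
have : #|D| > 0 by rewrite card_gt0.
move: tot; lia.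
Qed.

Lemma exists_safe_move : exists e u v i,
  [/\ e \in D, ends G e = [set u; v], i \in P u &
      forall X, tight D P X -> v \in X -> u \notin X -> i \notin mspan M (cup P X)].
Proof.
have [|Z /minsetP[/andP[tZ aZ] minZ] _] :=
  @minset_exists _ (fun X => tight D P X && has_active D P X) setT.
  by rewrite has_activeT andbT; case: tightT_rank.
have /exists_inP[e eD /existsP[u /existsP[v /and3P[/eqP Ee eZ nuv]]]] := aZ.
have [i iu niv] := subsetPn nuv.
exists e, u, v, i; split=> // X tX vX uX; apply/negP=> iX.
have := eZ; rewrite Ee subUset !sub1set => /andP[uZ vZ].
have vY : v \in X :&: Z by rewrite inE vX.
have Y0 : X :&: Z != set0 by apply/set0Pn; exists v.
have [tY eqr] := tightI tX tZ Y0.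
(* By minimality an active [X :&: Z] would be all of [Z], but [u] lies in [Z] and not in [X]. *)
have nY : ~~ has_active D P (X :&: Z).
  apply/negP=> aY; have := minZ (X :&: Z); rewrite tY aY subsetIr.
  by move=> /(_ isT isT) YZ; move: uZ uX; rewrite -YZ inE => /andP[->].
have rY := rank_inactive_tight tY nY vY.
case/negP: niv; apply: (subsetP (mspan_rank_eq (sub_cup P vY) _)).
  by rewrite rY indep_mrank.
rewrite inE eqn_leq andbC mrankS ?subsetUr //=.
(* Adding [i] to [cup P X] changes neither its rank nor its union with [cup P Z], so by [eqr] it
   cannot raise the rank of [cup P (X :&: Z)] either. *)
have := mrank_submod M (i |: cup P X) (cup P Z).
move: iX; rewrite inE => /eqP ->.
have iZ : i \in cup P Z by apply: (subsetP (sub_cup P uZ)).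
have -> : (i |: cup P X) :|: cup P Z = cup P (X :|: Z).
  by rewrite -setUA -cupU (setUidPr _) // sub1set cupU inE iZ orbT.
have : rk (i |: cup P (X :&: Z)) <= rk ((i |: cup P X) :&: cup P Z).
  by apply: mrankS; rewrite subUset sub1set !inE eqxx iZ subsetI subsetU ?cupS
    ?subsetIl ?subsetIr ?orbT.
by clear -eqr; lia.
Qed.

(** [P'] records that the tree of [i] has reached [v] along [e]. *)
Lemma state_step : exists e u v i,
  [/\ e \in D, ends G e = [set u; v], i \in P u, i \notin P v &
   let P' := fun w => if w == v then i |: P w else P w in
   [/\ forall w, indep M (P' w), sparse (D :\ e) P' &
       #|D :\ e| + \sum_w #|P' w| = k * #|V|]].
Proof.
have [e [u [v [i [eD Ee iu safe]]]]] := exists_safe_move.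
have uv := edge_neq eD Ee.
(* The singleton of [v] is tight, so safety puts [i] outside the span of [P v]; this keeps [P' v]
   independent. *)
have := safe _ (tight1 v); rewrite inE eqxx inE uv cup1 => /(_ isT isT) niv.
have iPv : i \notin P v by apply: contra niv; apply/subsetP/sub_mspan.
exists e, u, v, i; split=> // P'.
have P'v : P' v = i |: P v by rewrite /P' eqxx.
have P'n w : w != v -> P' w = P w by rewrite /P' => /negPf->.
have cP'v : #|P' v| = #|P v|.+1 by rewrite P'v cardsU1 iPv.
have sPP' w : P w \subset P' w by rewrite /P'; case: eqP => // _; apply: subsetUr.
have sumP' X : v \in X -> \sum_(w in X) #|P' w| = (\sum_(w in X) #|P w|).+1.
  move=> vX; rewrite !(big_setD1 v vX) /= cP'v addSn; congr (_ + _).+1.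
  by apply: eq_bigr => w /setD1P[wv _]; rewrite P'n.
split.
- move=> w; have [->|wv] := eqVneq w v; last by rewrite P'n.
  apply: mrank_card_indep; rewrite cP'v P'v mrank_notin_span //.
  by rewrite indep_mrank.
- move=> X X0; have := sp X0; rewrite /demand /capacity.
  have rkX : rk (cup P X) <= rk (cup P' X).
    apply: mrankS; apply/bigcupsP=> w wX; apply: subset_trans (sPP' w) _.
    exact: sub_cup.
  have sub_ind : #|induced G (D :\ e) X| <= #|induced G D X|.
    by apply: subset_leq_card; apply/subsetP=> f; rewrite !inE -andbA => /andP[_].
  (* With [v] outside [X] the demand does not grow; with both ends inside, the loss of [e] pays for
     [i]; with only [v] inside, a tight [X] gains rank by safety and any other has slack. *)
  have [vX|vX] := boolP (v \in X); last first.
    have -> : \sum_(w in X) #|P' w| = \sum_(w in X) #|P w|.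
      by apply: eq_bigr => w wX; rewrite P'n //; apply: contraNneq vX => <-.
    lia.
  rewrite sumP' //; have [uX|uX] := boolP (u \in X).
    have : #|induced G (D :\ e) X| < #|induced G D X|.
      apply: proper_card; apply/properP; split.
        by apply/subsetP=> f; rewrite !inE -andbA => /andP[_].
      by exists e; rewrite !inE ?eqxx // eD Ee subUset !sub1set uX.
    lia.
  have [tX|ntX] := boolP (tight D P X).
    have := mrank_notin_span (safe X tX vX uX).
    have : rk (i |: cup P X) <= rk (cup P' X).
      apply: mrankS; rewrite subUset sub1set; apply/andP; split.
        by apply: (subsetP (sub_cup P' vX)); rewrite P'v setU11.
      by apply/bigcupsP=> w wX; apply: subset_trans (sPP' w) (sub_cup P' wX).
    lia.
  move: ntX; rewrite /tight X0 /= /demand /capacity; lia.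
- have := sumP' setT (in_setT v).
  have toT Q : \sum_(w in [set: V]) #|(Q w : {set I})| = \sum_w #|Q w|.
    by apply: eq_bigl => w; rewrite inE.
  rewrite !toT => ->; move: tot; rewrite (cardsD1 e D) eD; lia.
Qed.

End State.
End Exchange.

(** * Forests, connected edge sets and rooted trees *)

Lemma zip_cons_rcons (A : Type) (x y : A) (p : seq A) :
  zip (x :: p) (rcons p y) = rcons (zip (x :: p) p) (last x p, y).
Proof. by elim: p x => //= z p IH x; rewrite -IH. Qed.

Section Forests.
Variables (V E : finType) (G : mgraph V E).
Implicit Types (F T : {set E}) (e : E) (u v w x : V) (W S : {set V}).

Lemma adj_sym F : symmetric (adj G F).
Proof. by move=> u v; apply: eq_existsb => e; rewrite setUC. Qed.

Lemma connect_adj_sym F : connect_sym (adj G F).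
Proof. exact/sym_connect_sym/adj_sym. Qed.

Lemma adjS F F' : F \subset F' -> subrel (adj G F) (adj G F').
Proof.
move=> sF u v /exists_inP[e eF Ee]; apply/exists_inP; exists e => //.
exact: (subsetP sF).
Qed.

Lemma connect_adjS F F' : F \subset F' -> subrel (connect (adj G F)) (connect (adj G F')).
Proof.
by move=> sF; apply: connect_sub => u v uv; apply/connect1/(adjS sF).
Qed.

Lemma mem_zip_pair (A B : eqType) (s : seq A) (s' : seq B) q :
  q \in zip s s' -> (q.1 \in s) && (q.2 \in s').
Proof.
elim: s s' => [|a s IH] [|b s'] //=; rewrite !inE => /orP[/eqP->|/IH/andP[-> ->]] /=.
  by rewrite !eqxx.
by rewrite !orbT.
Qed.

(** The vertex [x] is in the first pair and in no later one. Distinct pairs make the edges of a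
    simple path distinct. *)
Lemma uniq_path_pairs (x : V) (p : seq V) : uniq (x :: p) ->
  uniq [seq [set q.1; q.2] | q <- zip (x :: p) p].
Proof.
elim: p x => //= y p IH x /andP[xp yp]; rewrite (IH y) // andbT.
apply/negP=> /mapP[[a b] /mem_zip_pair /= /andP[a_in b_in] xE].
have : x \in [set a; b] by rewrite -xE !inE eqxx.
rewrite !inE => /orP[] /eqP xab; case/negP: xp; first by rewrite xab.
by rewrite xab inE b_in orbT.
Qed.

Lemma path_edges F x p : path (adj G F) x p ->
  exists2 es : seq E, {subset es <= F} &
    [seq ends G e | e <- es] = [seq [set q.1; q.2] | q <- zip (x :: p) p].
Proof.
elim: p x => [|y p IH] x /=; first by exists [::].
case/andP=> /exists_inP[e eF /eqP Ee] /IH[es sF Ees].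
exists (e :: es); last by rewrite /= Ee Ees.
by move=> f; rewrite inE => /predU1P[->|/sF].
Qed.

Lemma acyclicS F F' : F \subset F' -> acyclic G F' -> acyclic G F.
Proof.
move=> sF aF vs es [es0 uvs ues sesF E_]; apply: (aF vs es).
by split=> // f /sesF /(subsetP sF).
Qed.

Lemma acyclic_edge_disconnects F e u v : acyclic G F -> e \in F ->
  ends G e = [set u; v] -> ~~ connect (adj G (F :\ e)) u v.
Proof.
move=> aF eF Ee; apply/negP=> /connectP[p' p'P vE].
case/shortenP: p'P vE => p pP up _ vE.
have [es sF Ees] := path_edges pP.
apply: (aF (u :: p) (rcons es e)); split=> //.
- by case: (es).
- rewrite rcons_uniq; apply/andP; split.
    by apply/negP=> /sF; rewrite !inE eqxx.
  by apply: (@map_uniq _ _ (ends G)); rewrite Ees uniq_path_pairs.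
- by move=> f; rewrite mem_rcons inE => /predU1P[->//|/sF/setD1P[]].
(* The cyclic pairing of [is_cycle] consists of the steps of the path and a closing pair, joined by
   [e]. *)
- by rewrite map_rcons Ees rot1_cons zip_cons_rcons map_rcons Ee /= -vE setUC.
Qed.

(** Deleting an edge splits [W] into two non-empty sides with no remaining edge between them, and
    induction applies to each. [W] may exceed [vset G F] because a side may have isolated
    vertices. *)
Lemma acyclic_card F W : acyclic G F -> vset G F \subset W -> W != set0 ->
  #|F| < #|W|.
Proof.
have [n] := ubnP #|F|; elim: n F W => // n IH F W ltFn aF sFW W0.
have [->|[e eF]] := set_0Vmem F; first by rewrite cards0 card_gt0.
have [u [v Ee]] := ends_pair G e.
have := acyclic_edge_disconnects aF eF Ee; set F' := F :\ e => nuv.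
have [sF'F cF] : F' \subset F /\ #|F| = #|F'|.+1.
  by rewrite subD1set [in LHS](cardsD1 e) eF.
set C := [set w in W | connect (adj G F') u w].
have sub2 : {subset [:: u; v] <= W}.
  move=> w; rewrite !inE => wuv; apply: (subsetP sFW).
  by apply: (subsetP (sub_ends_vset G eF)); rewrite Ee !inE.
have card_side S : S != set0 -> #|induced G F' S| < #|S|.
  have sS : induced G F' S \subset F' by apply/subsetP=> f; rewrite inE => /andP[].
  apply: IH.
  - by have := subset_leq_card sS; move: ltFn; rewrite cF; lia.
  - by apply: acyclicS aF; apply: subset_trans sF'F.
  - by apply/vset_subP=> f; rewrite inE => /andP[].
have : #|induced G F' C| < #|C|.
  by apply: card_side; apply/set0Pn; exists u; rewrite inE connect0 sub2 ?mem_head.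
have : #|induced G F' (W :\: C)| < #|W :\: C|.
  apply: card_side; apply/set0Pn; exists v.
  by rewrite !inE (negPf nuv) andbF sub2 // !inE eqxx orbT.
have : #|F'| <= #|induced G F' C| + #|induced G F' (W :\: C)|.
  rewrite (leq_trans _ (leq_card_setU _ _)) // subset_leq_card //.
  apply/subsetP=> f fF'; rewrite inE [in X in _ || X]inE [in X in X || _]inE fF' /=.
  have [a [b Ef]] := ends_pair G f.
  have := subset_trans (sub_ends_vset G (subsetP sF'F f fF')) sFW.
  rewrite Ef !subUset !sub1set !in_setD => /andP[aW bW].
  have CE : (a \in C) = (b \in C).
    have ab : adj G F' a b by apply/exists_inP; exists f; rewrite ?Ef.
    by rewrite !inE aW bW (same_connect_r (connect_adj_sym F') (connect1 ab)).
  by rewrite aW bW CE; case: (b \in C).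
have : #|W| = #|C| + #|W :\: C|.
  by rewrite -(cardsID C W) (setIidPr _) //; apply/subsetP=> w; rewrite inE => /andP[].
clear -cF; lia.
Qed.

(** Conversely, a cycle has at least as many edges as vertices. *)
Lemma acyclicP F :
  acyclic G F <-> forall F', F' \subset F -> F' != set0 -> #|F'| < #|vset G F'|.
Proof.
split=> [aF F' sF' F'0|H vs es [es0 uvs ues sesF E_]].
  apply: acyclic_card => //; first exact: acyclicS aF.
  have [e eF] := set0Pn _ F'0; have [u [v Ee]] := ends_pair G e.
  apply/set0Pn; exists u; apply: (subsetP (sub_ends_vset G eF)).
  by rewrite Ee !inE eqxx.
have := H [set e in es]; rewrite cardsE (card_uniqP ues).
have szE : size es = size vs.
  by rewrite -(size_map (ends G)) E_ size_map size_zip size_rot minnn.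
have -> : [set e in es] \subset F by apply/subsetP=> e; rewrite inE => /sesF.
have -> : [set e in es] != set0.
  by case: (es) es0 => // e es' _; apply/set0Pn; exists e; rewrite !inE eqxx.
move=> /(_ isT isT); rewrite ltnNge szE => /negP; apply.
rewrite -(card_uniqP uvs) subset_leq_card //; apply/subsetP=> v.
case/bigcupP=> e; rewrite inE => /(map_f (ends G)); rewrite E_.
case/mapP=> -[a b] /mem_zip_pair /= /andP[a_in b_in] ->.
by rewrite mem_rot in b_in; rewrite !inE => /orP[] /eqP->.
Qed.

(** Grow [S] from [x]: connectivity gives an edge leaving [S], and each new vertex uses up at least
    one of the edges not yet inside [S]. *)
Lemma connected_card T x : connected_edges G T -> x \in vset G T ->
  #|vset G T| <= #|T|.+1.
Proof.
move=> cT xT.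
suff grow n S : #|vset G T :\: S| = n -> x \in S -> S \subset vset G T ->
    n <= #|T :\: induced G T S|.
  have := grow _ [set x] erefl; rewrite set11 sub1set xT => /(_ isT isT) le.
  rewrite (cardsD1 x) xT ltnS (leq_trans le) // subset_leq_card //.
  exact: subsetDl.
elim: n S => // n IH S cS xS sS.
have [y yS] : exists y, y \in vset G T :\: S by apply/card_gt0P; rewrite cS.
have [yT yNS] := setDP yS.
have [a [b [aS bS ab]]] : exists a b, [/\ a \in S, b \notin S & adj G T a b].
  have /connectP[p pP yE] := cT x y xT yT.
  elim: p (x) xS pP yE => [|z p IHp] w wS /= => [_ yE|/andP[wz pP] yE].
    by rewrite yE wS in yNS.
  have [zS|zS] := boolP (z \in S); first exact: IHp zS pP yE.
  by exists w, z.
have /exists_inP[e eT /eqP Ee] := ab.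
have bT : b \in vset G T.
  by apply: (subsetP (sub_ends_vset G eT)); rewrite Ee !inE eqxx orbT.
have lt : #|T :\: induced G T (b |: S)| < #|T :\: induced G T S|.
  apply: proper_card; apply/properP; split.
    apply: setDS; apply/subsetP=> f; rewrite !inE => /andP[-> /= s].
    exact: subset_trans s (subsetUr _ _).
  exists e; first by rewrite !inE eT Ee subUset !sub1set (negPf bS) andbF.
  by rewrite !inE eT Ee subUset !sub1set !inE aS eqxx orbT.
apply: leq_ltn_trans lt; apply: IH.
- rewrite setDUr setIC; apply: succn_inj; rewrite -cS (cardsD1 b (vset G T :\: S)).
  rewrite !inE bS bT; congr _.+1; apply: eq_card => w; rewrite !inE.
  by case: (w \in S); case: (w == b); case: (w \in vset G T).
- by rewrite inE xS orbT.
- by rewrite subUset sub1set bT.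
Qed.

Lemma rooted_vset_id T x : x \in vset G T -> rooted_vset G T x = vset G T.
Proof. by move=> xT; apply/setUidPr; rewrite sub1set. Qed.

Lemma rooted_vset0 x : rooted_vset G set0 x = [set x].
Proof. by rewrite /rooted_vset /vset big_set0 setU0. Qed.

Lemma rooted_tree_card T x : rooted_tree G T x -> #|rooted_vset G T x| = #|T|.+1.
Proof.
case=> [->|[cT aT xT]]; first by rewrite rooted_vset0 cards1 cards0.
have -> : rooted_vset G T x = vset G T by apply: rooted_vset_id.
apply/eqP; rewrite eqn_leq (connected_card cT xT) /=.
by apply: acyclic_card => //; apply/set0Pn; exists x.
Qed.

Lemma rooted_tree_acyclic T x : rooted_tree G T x -> acyclic G T.
Proof.
case=> [->|[_ aT _] //]; apply/acyclicP=> F'.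
by rewrite subset0 => /eqP->; rewrite eqxx.
Qed.

Lemma rooted_vset_addedge T x e u v : u \in rooted_vset G T x ->
  ends G e = [set u; v] -> rooted_vset G (e |: T) x = v |: rooted_vset G T x.
Proof.
rewrite /rooted_vset vsetU1 => uT ->; apply/setP=> w; rewrite !inE.
by have [->|] := eqVneq w u; move: uT; rewrite !inE;
   case: (w == v); case: (w == x) => //= ->; rewrite ?orbT.
Qed.

Lemma rooted_tree_pendant T x e u v : rooted_tree G T x ->
  u \in rooted_vset G T x -> v \notin rooted_vset G T x ->
  ends G e = [set u; v] -> rooted_tree G (e |: T) x.
Proof.
move=> tT uT vT Ee; right.
have uv : u != v by apply: contraNneq vT => <-.
have xE : x \in vset G (e |: T).
  rewrite vsetU1 Ee; move: tT uT => [->|[_ _ xT] _].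
    by rewrite rooted_vset0 !inE => /eqP->; rewrite eqxx.
  by rewrite inE xT orbT.
have VE : vset G (e |: T) = v |: rooted_vset G T x.
  by rewrite -(rooted_vset_addedge uT Ee) rooted_vset_id.
split=> //.
- have xconn w : w \in vset G (e |: T) -> connect (adj G (e |: T)) x w.
    have oldc w' : w' \in rooted_vset G T x -> connect (adj G (e |: T)) x w'.
      case: tT => [->|[cT _ xT]].
        by rewrite rooted_vset0 inE => /eqP->; apply: connect0.
      rewrite rooted_vset_id // => w'T.
      by apply: connect_adjS (cT _ _ xT w'T); apply: subsetUr.
    rewrite VE => /setU1P[->|]; last exact: oldc.
    apply: connect_trans (oldc u uT) (connect1 _).
    by apply/exists_inP; exists e; rewrite ?setU11 ?Ee.
  move=> a b /xconn xa /xconn xb; apply: connect_trans xb.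
  by rewrite connect_adj_sym.
- apply/acyclicP=> F' sF' F'0; have aT := rooted_tree_acyclic tT.
  have sF'T : F' :\ e \subset T by rewrite subDset.
  have [eF'|eF'] := boolP (e \in F'); last first.
    move/acyclicP: aT; apply => //; apply: subset_trans sF'T.
    by rewrite subsetD1 subxx.
  rewrite (cardsD1 e) eF' -(setD1K eF') vsetU1 Ee setU1K ?setD11 //.
  (* For [e] alone the bound is [u != v]. Otherwise restoring [e] adds one edge and at least the new
     vertex [v]. *)
  have [->|F0] := eqVneq (F' :\ e) set0.
    by rewrite cards0 /vset big_set0 setU0 cards2 uv.
  have vF' : v \notin vset G (F' :\ e).
    apply: contra vT => vF'; apply/setU1r.
    exact: (subsetP (vsetS G sF'T)).
  have := (acyclicP T).1 aT _ sF'T F0.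
  have : #|v |: vset G (F' :\ e)| <= #|[set u; v] :|: vset G (F' :\ e)|.
    by apply: subset_leq_card; rewrite -setUA subsetUr.
  rewrite cardsU1 vF'; clear; lia.
Qed.

End Forests.

(** * Double counting over a family of trees *)

Lemma double_count (I V : finType) (Q : I -> {set V}) (X : {set V}) :
  \sum_(v in X) #|[set i | v \in Q i]| = \sum_i #|X :&: Q i|.
Proof.
transitivity (\sum_(v in X) \sum_(i | v \in Q i) 1).
  by apply: eq_bigr => v _; rewrite sum1dep_card.
rewrite (exchange_big_dep xpredT) //=; apply: eq_bigr => i _.
by rewrite sum1dep_card; apply: eq_card => v; rewrite !inE.
Qed.

Section Decomposition.
Variables (V E : finType) (G : mgraph V E) (t : nat) (r : 'I_t -> V).
Variable M : matroid 'I_t.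
Implicit Types (D F : {set E}) (X : {set V}) (T : 'I_t -> {set E}).

Local Notation k := (mrank M setT).

(** The sets [P v] of the growth process, read off from the trees. *)
Definition reach T v : {set 'I_t} := [set i | v \in rooted_vset G (T i) (r i)].

Lemma mem_reach T v i : (i \in reach T v) = (v \in rooted_vset G (T i) (r i)).
Proof. exact: in_set. Qed.

Lemma sum_reach T X : (forall v, is_base M (reach T v)) ->
  \sum_i #|X :&: rooted_vset G (T i) (r i)| = k * #|X|.
Proof.
move=> bT; rewrite -double_count (eq_bigr (fun=> k)) ?sum_nat_const 1?mulnC // => v _.
by have := bT v; rewrite is_baseE => /andP[_ /eqP].
Qed.

Lemma sum_partition T F : \bigcup_i T i = [set: E] ->
    (forall i j, i != j -> [disjoint T i & T j]) ->
  \sum_i #|F :&: T i| = #|F|.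
Proof.
move=> covT disT; rewrite -double_count -sum1_card; apply: eq_bigr => e _.
have : e \in \bigcup_i T i by rewrite covT inE.
case/bigcupP=> i _ ei; apply/eqP/cards1P; exists i; apply/setP=> j.
rewrite !inE; apply/idP/eqP=> [ej|->//].
apply/eqP/negPn/negP=> /disT; rewrite disjoint_sym disjoints_subset.
by move/subsetP/(_ e ei); rewrite inE ej.
Qed.

(** * Necessity of the three conditions *)

Section Necessity.
Variable T : 'I_t -> {set E}.
Hypothesis decT : basic_rooted_tree_decomposition G r M T.

Lemma decomposition_indep v : indep M (roots_at r v).
Proof.
have [_ _ _ /(_ v)] := decT; rewrite is_baseE => /andP[iv _].
by apply: indepS iv; apply/subsetP=> i; rewrite !inE => /eqP->; rewrite eqxx.
Qed.

Lemma decomposition_card : #|E| + t = k * #|V|.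
Proof.
have [covT disT treeT baseT] := decT.
have := sum_reach setT baseT; have := sum_partition setT covT disT.
rewrite !cardsT => <- <-.
transitivity (\sum_i (#|[set: E] :&: T i| + 1)).
  by rewrite big_split /= sum1_card card_ord.
by apply: eq_bigr => i _; rewrite !setTI rooted_tree_card ?addn1.
Qed.

Lemma decomposition_sparse F : F != set0 ->
  #|F| + #|roots_in G r F| + k <= k * #|vset G F| + mrank M (roots_in G r F).
Proof.
move=> F0; have [covT disT treeT baseT] := decT.
set X := vset G F; set I := cup (reach T) X.
have [v vX] : exists v, v \in X.
  have [e eF] := set0Pn _ F0; have [u [w Ee]] := ends_pair G e; exists u.
  by apply: (subsetP (sub_ends_vset G eF)); rewrite Ee !inE eqxx.
have rI : k <= mrank M I.
  have := baseT v; rewrite is_baseE => /andP[iv /eqP <-].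
  by rewrite -(indep_mrank iv) mrankS // (@sub_cup _ _ (reach T)).
have sRI : roots_in G r F \subset I.
  apply/subsetP=> i; rewrite inE => ri; apply/bigcupP; exists (r i) => //.
  by rewrite !inE eqxx.
(* Since [I] has rank at least [k], the rank of [R_F] is at least [k - (#|I| - #|R_F|)]; what
   remains is [#|F| + #|I| <= k * #|X|]. *)
have := mrankU_card M (roots_in G r F) (I :\: roots_in G r F).
rewrite -{1}(setIidPr sRI) setID cardsD (setIidPr sRI).
have := subset_leq_card sRI.
suff : #|F| + #|I| <= k * #|X| by lia.
have <- : \sum_i (i \in I) = #|I| by rewrite -big_mkcond sum1_card.
(* Compare termwise: if the tree of [i] meets [X], the forest [F :&: T i] has fewer than [#|W|]
   edges; otherwise it is empty. *)
rewrite -(sum_reach X baseT) -(sum_partition F covT disT) -big_split.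
apply: leq_sum => i _ /=; set W := X :&: _.
have sW : vset G (F :&: T i) \subset W.
  rewrite subsetI vsetS ?subsetIl //=.
  by apply: subset_trans (vsetS _ (subsetIr F (T i))) (subsetUr _ _).
have [iI|iI] := boolP (i \in I).
  rewrite addn1; apply: acyclic_card sW _.
    exact: acyclicS (subsetIr F (T i)) (rooted_tree_acyclic (treeT i)).
  have /bigcupP[w wX] := iI; rewrite inE => wi.
  by apply/set0Pn; exists w; rewrite inE wX.
have [->|[e eFT]] := set_0Vmem (F :&: T i); first by rewrite cards0.
have [u [w Ee]] := ends_pair G e.
have : u \in W.
  by apply/(subsetP sW)/(subsetP (sub_ends_vset G eFT)); rewrite Ee !inE eqxx.
rewrite inE => /andP[uX ui]; case/negP: iI; apply/bigcupP.
by exists u => //; rewrite inE.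
Qed.

End Necessity.

(** * Sufficiency: growing the trees *)

Section Sufficiency.
Hypothesis indep_roots : forall v, indep M (roots_at r v).
Hypothesis sparse_roots : forall F, F != set0 ->
  #|F| + #|roots_in G r F| + k <= k * #|vset G F| + mrank M (roots_in G r F).
Hypothesis total_roots : #|E| + t = k * #|V|.

Lemma sum_roots_at X : \sum_(v in X) #|roots_at r v| = #|[set i | r i \in X]|.
Proof.
rewrite -sum1dep_card (big_mkcond (fun i => r i \in X)).
rewrite (eq_bigr (fun v => #|[set i | v \in [set r i]]|)); last first.
  by move=> v _; apply: eq_card => i; rewrite !inE eq_sym.
rewrite double_count; apply: eq_bigr => i _.
have [rX|rX] := ifPn (r i \in X); first by rewrite (setIidPr _) ?cards1 ?sub1set.
apply/eqP; rewrite cards_eq0 setI_eq0 disjoint_sym disjoints_subset.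
by rewrite sub1set inE.
Qed.

Lemma cup_roots_at X : cup (roots_at r) X = [set i | r i \in X].
Proof.
apply/setP=> i; rewrite inE; apply/bigcupP/idP=> [[v vX]|rX].
  by rewrite inE => /eqP->.
by exists (r i) => //; rewrite inE.
Qed.

(** (C2) speaks only of sets [vset G F]. Take for [W] the vertices covered by the edges inside [X],
    or a singleton if there are none; each further vertex of [X] adds at most [k] to the demand, by
    (C1), and exactly [k] to [k * #|X|]. *)
Lemma sparse_init : sparse G M setT (roots_at r).
Proof.
move=> X X0; rewrite /demand /capacity; set F := induced G setT X.
have sFX : vset G F \subset X by apply/vset_subP=> e; rewrite inE => /andP[].
suff [W [W0 sWX leW]] : exists W, [/\ W != set0, W \subset X &
    #|F| + \sum_(v in W) #|roots_at r v| + k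
      <= k * #|W| + mrank M (cup (roots_at r) W)].
  rewrite (big_setID W (A := X)) /= (setIidPr sWX).
  have := mrankS M (cupS (roots_at r) sWX).
  have : \sum_(v in X :\: W) #|roots_at r v| <= k * #|X :\: W|.
    rewrite mulnC -sum_nat_const; apply: leq_sum => v _.
    by rewrite -(indep_mrank (indep_roots v)) mrankS.
  have -> : k * #|X| = k * #|W| + k * #|X :\: W|.
    by rewrite -mulnDr -(cardsID W X) (setIidPr sWX).
  move=> le_out le_rank; rewrite addnA addnAC [leqRHS]addnAC.
  apply: leq_add le_out; apply: leq_trans leW _; rewrite leq_add2l; exact: le_rank.
have [F0|F0] := eqVneq F set0.
  have [v vX] := set0Pn _ X0; exists [set v].
  rewrite sub1set -card_gt0 cards1; split=> //.
  by rewrite F0 cards0 /cup !big_set1 (indep_mrank (indep_roots v)); lia.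
exists (vset G F); split=> //; last first.
  by rewrite sum_roots_at cup_roots_at; apply: sparse_roots.
have [e eF] := set0Pn _ F0; have [u [w Ee]] := ends_pair G e.
apply/set0Pn; exists u; apply: (subsetP (sub_ends_vset G eF)).
by rewrite Ee !inE eqxx.
Qed.

Lemma complete_decomposition D P T :
    (forall v, P v = reach T v) -> D = ~: (\bigcup_i T i) ->
    (forall i j, i != j -> [disjoint T i & T j]) ->
    (forall i, rooted_tree G (T i) (r i)) ->
    (forall v, indep M (P v)) -> sparse G M D P ->
    #|D| + \sum_v #|P v| = k * #|V| ->
  admits_basic_rooted_tree_decomposition G r M.
Proof.
have [n] := ubnP #|D|; elim: n D P T => // n IH D P T ltDn PE DE disT treeT iP sP tot.
have [D0|D0] := eqVneq D set0.
  have covT : \bigcup_i T i = [set: E] by rewrite -[LHS]setCK -DE D0 setC0.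
  exists T; split=> // v; rewrite -[X in is_base M X]/(reach T v) -PE is_baseE iP /=.
  (* With [D] empty the sizes sum to [k * #|V|], so each attains its maximum [k]. *)
  have leP w : #|P w| <= k ?= iff (#|P w| == k).
    by split=> //; rewrite -(indep_mrank (iP w)) mrankS.
  have [_] := leqif_sum (fun w (_ : true) => leP w).
  rewrite sum_nat_const mulnC -tot D0 cards0 eqxx => /esym/forallP/(_ v).
  by [].
have [e [u [v [i [eD Ee iu iv [iP' sP' tot']]]]]] := state_step iP sP tot D0.
have eT j : e \notin T j.
  by apply: contraL eD => ej; rewrite DE inE negbK; apply/bigcupP; exists j.
(* Only the tree of [i] changes; as [i] is in [P u] and not in [P v], the edge [e] is pendant. *)
pose T' j := if j == i then e |: T i else T j.
have T'i : T' i = e |: T i by rewrite /T' eqxx.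
have T'n j : j != i -> T' j = T j by rewrite /T' => /negPf->.
have uTi : u \in rooted_vset G (T i) (r i) by rewrite PE inE in iu.
have vTi : v \notin rooted_vset G (T i) (r i) by rewrite PE inE in iv.
apply: (IH _ _ T') iP' sP' tot' => [||||j].
- by move: ltDn; rewrite (cardsD1 e D) eD.
- move=> w; apply/setP=> j; rewrite (fun_if (fun B : {set _} => j \in B)) in_setU1.
  rewrite !PE !mem_reach.
  have [->|ji] := eqVneq j i.
    by rewrite T'i (rooted_vset_addedge uTi Ee) in_setU1; case: (w == v).
  by rewrite T'n //; case: eqP => // ->.
- apply/setP=> f; rewrite DE !inE -negb_or; congr (~~ _).
  apply/idP/bigcupP=> [/predU1P[->|/bigcupP[j _ fj]]|[j _]].
  + by exists i; rewrite // T'i setU11.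
  + exists j => //; have [ji|ji] := eqVneq j i; last by rewrite T'n.
    by rewrite ji T'i -ji setU1r.
  + have [->|ji] := eqVneq j i; first rewrite T'i => /setU1P[->|fi].
    * by rewrite eqxx.
    * by apply/orP; right; apply/bigcupP; exists i.
    * by rewrite T'n // => fj; apply/orP; right; apply/bigcupP; exists j.
- have disT' j : j != i -> [disjoint e |: T i & T j].
    move=> ji; rewrite disjoint_sym disjoints_subset; apply/subsetP=> f fj.
    rewrite !inE negb_or; apply/andP; split; first by apply: contraTneq fj => ->.
    have := disT j i ji; rewrite disjoints_subset => /subsetP/(_ f fj).
    by rewrite inE.
  move=> j l jl; have [ji|ji] := eqVneq j i; have [li|li] := eqVneq l i.
  + by rewrite ji li eqxx in jl.
  + by rewrite ji T'i T'n // disT'.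
  + by rewrite li T'i T'n // disjoint_sym disT'.
  + by rewrite !T'n // disT.
- have [->|ji] := eqVneq j i; last by rewrite T'n.
  by rewrite T'i; apply: rooted_tree_pendant (treeT i) uTi vTi Ee.
Qed.

Lemma sparse_admits_decomposition : admits_basic_rooted_tree_decomposition G r M.
Proof.
(* Initially every tree is its bare root, so [P v] is [R_v]. *)
apply: (@complete_decomposition setT (roots_at r) (fun=> set0)) => //.
- by move=> v; apply/setP=> i; rewrite mem_reach rooted_vset0 !inE eq_sym.
- by rewrite big1 // setC0.
- by move=> i j _; rewrite -setI_eq0 setI0.
- by left.
- exact: sparse_init.
rewrite cardsT -total_roots; congr (_ + _).
transitivity #|[set i | r i \in [set: V]]|.
  by rewrite -sum_roots_at; apply: eq_bigl => v; rewrite inE.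
suff -> : [set i | r i \in [set: V]] = setT by rewrite cardsT card_ord.
by apply/setP=> i; rewrite !inE.
Qed.

End Sufficiency.
End Decomposition.

Theorem theorem1p2 (V E : finType) (G : mgraph V E) (t : nat) (r : 'I_t -> V)
    (M : matroid 'I_t) (k : nat) (hk : mrank M [set: 'I_t] = k) :
  admits_basic_rooted_tree_decomposition G r M <->
  [/\ forall v : V, indep M (roots_at r v),
      forall F : {set E}, F != set0 ->
        (#|F|%:Z + #|roots_in G r F|%:Z <=
         k%:Z * #|vset G F|%:Z - k%:Z + (mrank M (roots_in G r F))%:Z)%R
    & #|E| + t = k * #|V|].
Proof.
rewrite -hk; split=> [[T decT]|[C1 C2 C3]].
  split; [exact: decomposition_indep decT| |exact: decomposition_card decT].
  by move=> F /(decomposition_sparse decT); lia.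
by apply: sparse_admits_decomposition C1 _ C3 => F /C2; lia.
Qed.
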